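(* Let $\mathbf{Top}^2_{cr}$ be the category whose objects are pairs $(X,A)$ consisting of a completely regular space $X$ and a completely closed subset $A\subset X$, and whose morphisms $(X,A)\to(Y,B)$ are continuous maps $f:X\to Y$ with $f(A)\subset B$. Let $G$ be an abelian group and $n$ an integer. Then the assignments $(X,A)\mapsto\check H_n^F(X,A;G)$, $f\mapsto f_*$ and $(X,A)\mapsto\hat H^n_F(X,A;G)$, $f\mapsto f^*$ define, respectively, a covariant functor and a contravariant functor $$\check{H}_n^F(-,-;G):\mathbf{Top}^2_{cr}\to\mathbf{Ab},\qquad \hat{H}^n_F(-,-;G):\mathbf{Top}^2_{cr}\to\mathbf{Ab}$$ to the category of abelian groups.
   Context: Completely regular spaces are Tychonoff spaces. A subset $A\subset X$ is completely closed if it is closed and every continuous map $A\to[0,1]$ extends to a continuous map $X\to[0,1]$. A subset $U\subset X$ is functionally open if $U=f^{-1}((0,1])$ for some continuous $f:X\to[0,1]$. Let $cov_F(X)$ be the set of finite indexed covers $\alpha=\{\alpha_v\}_{v\in V_\alpha}$ of $X$ by functionally open sets, directed by refinement: $\alpha\le\alpha'$ iff every member of $\alpha'$ is contained in a member of $\alpha$. For $\alpha\in cov_F(X)$ the nerve $X_\alpha$ is the simplicial complex of nonempty finite $s\subset V_\alpha$ with $\bigcap_{v\in s}\alpha_v\neq\emptyset$, and $A_\alpha\subset X_\alpha$ is the subcomplex of those $s$ with $A\cap\bigcap_{v\in s}\alpha_v\ne\emptyset$. $H_n(X_\alpha,A_\alpha;G)$ and $H^n(X_\alpha,A_\alpha;G)$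 are the simplicial homology and cohomology groups with coefficients in $G$. For $\alpha\le\alpha'$ any refinement projection $p_{\alpha\alpha'}:V_{\alpha'}\to V_\alpha$ (with $\alpha'_{v}\subset\alpha_{p_{\alpha\alpha'}(v)}$) is a simplicial map $(X_{\alpha'},A_{\alpha'})\to(X_\alpha,A_\alpha)$; the induced homomorphisms $p_{\alpha\alpha'*}$ on homology and $p_{\alpha\alpha'}^*$ on cohomology do not depend on its choice. The functional homology and cohomology groups are $$\check H_n^F(X,A;G)=\varprojlim\{H_n(X_\alpha,A_\alpha;G),p_{\alpha\alpha'*},cov_F(X)\},\quad \hat H^n_F(X,A;G)=\varinjlim\{H^n(X_\alpha,A_\alpha;G),p^*_{\alpha\alpha'},cov_F(X)\}.$$ Induced homomorphisms: for a morphism $f:(X,A)\to(Y,B)$ and $\beta=\{\beta_v\}_{v\in V_\beta}\in cov_F(Y)$, put $\alpha=f^{-1}\beta=\{f^{-1}(\beta_v)\}_{v\in V_\beta}\in cov_F(X)$. Then $X_\alpha$ is a subcomplex of $Y_\beta$ and $A_\alpha$ of $B_\beta$; let $f_\beta:(X_\alpha,A_\alpha)\to(Y_\beta,B_\beta)$ be the inclusion. The homomorphisms $f_{\beta*}$ and $f_\beta^*$ commute with the maps $p_*$ and $p^*$ of the respective systems, and their limits are $f_*:\check H_n^F(X,A;G)\to\check H_n^F(Y,B;G)$ and $f^*:\hat H_F^n(Y,B;G)\to\hat H_F^n(X,A;G)$. *)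

(* Defs.v *)
From HB Require Import structures.
From mathcomp Require Import all_boot all_order all_algebra.
From mathcomp Require Import all_classical all_reals all_analysis.
Import numFieldNormedType.Exports.

Set Implicit Arguments.
Unset Strict Implicit.
Unset Printing Implicit Defensive.

Import Order.TTheory GRing.Theory Num.Theory.
Local Open Scope classical_set_scope.
Local Open Scope ring_scope.

Record category := Category {
  obj :> Type;
  hom : obj -> obj -> Type;
  idc : forall X, hom X X;
  compc : forall X Y Z, hom Y Z -> hom X Y -> hom X Z;
  idcl : forall X Y (f : hom X Y), compc (idc Y) f = f;
  idcr : forall X Y (f : hom X Y), compc f (idc X) = f;
  compcA : forall X Y Z W (h : hom Z W) (g : hom Y Z) (f : hom X Y),
    compc h (compc g f) = compc (compc h g) f }.

Arguments hom {c} X Y.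
Arguments idc {c} X.
Arguments compc {c X Y Z} g f.

Definition is_functor (C D : category) (F : C -> D)
    (Fmap : forall X Y : C, hom X Y -> hom (F X) (F Y)) : Prop :=
  (forall X : C, Fmap X X (idc X) = idc (F X)) /\
  (forall (X Y Z : C) (g : hom Y Z) (f : hom X Y),
     Fmap X Z (compc g f) = compc (Fmap Y Z g) (Fmap X Y f)).

Definition is_contravariant_functor (C D : category) (F : C -> D)
    (Fmap : forall X Y : C, hom X Y -> hom (F Y) (F X)) : Prop :=
  (forall X : C, Fmap X X (idc X) = idc (F X)) /\
  (forall (X Y Z : C) (g : hom Y Z) (f : hom X Y),
     Fmap X Z (compc g f) = compc (Fmap X Y f) (Fmap Y Z g)).

Lemma additive_eq (U V : zmodType) (f g : {additive U -> V}) : f =1 g -> f = g.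
Proof.
case: f => f [[fM]]; case: g => g [[gM]] /= /funext fg.
by case: g / fg gM => gM; rewrite (Prop_irrelevance fM gM).
Qed.

Lemma Ab_idl (U V : zmodType) (f : {additive U -> V}) :
  (idfun \o f : {additive U -> V}) = f.
Proof. exact: additive_eq. Qed.
Lemma Ab_idr (U V : zmodType) (f : {additive U -> V}) :
  (f \o idfun : {additive U -> V}) = f.
Proof. exact: additive_eq. Qed.
Lemma Ab_compA (U V W X : zmodType) (h : {additive W -> X})
    (g : {additive V -> W}) (f : {additive U -> V}) :
  (h \o (g \o f) : {additive U -> X}) = ((h \o g) \o f : {additive U -> X}).
Proof. exact: additive_eq. Qed.

(* A [zmodType] is an abelian group; the choice structure it also carries is
   no restriction classically and is not preserved by morphisms. *)
Definition Ab : category := @Category zmodType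
  (fun U V => {additive U -> V}) (fun U => idfun) (fun U V W g f => g \o f)
  Ab_idl Ab_idr Ab_compA.

Record subgroup (M : zmodType) := Subgroup {
  subgroup_set :> M -> Prop;
  subgroup_closed : subgroup_set 0 /\
    forall x y, subgroup_set x -> subgroup_set y -> subgroup_set (x - y) }.

Section Subgroup.
Variables (M : zmodType) (S : subgroup M).

Definition subgroup_pred : {pred M} := fun x => `[< S x >].

Lemma subgroup_pred_closed : zmod_closed subgroup_pred.
Proof.
have [S0 SB] := subgroup_closed S.
split=> [|x y /asboolP Sx /asboolP Sy]; apply/asboolP => //; exact: SB.
Qed.
HB.instance Definition _ :=
  GRing.isZmodClosed.Build M subgroup_pred subgroup_pred_closed.

Record subgroup_type := SubgroupType {
  subgroup_val :> M; subgroup_valP : subgroup_pred subgroup_val }.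
HB.instance Definition _ := [isSub for subgroup_val].
HB.instance Definition _ := [Choice of subgroup_type by <:].
HB.instance Definition _ := [SubChoice_isSubZmodule of subgroup_type by <:].

Lemma subgroupP (x : subgroup_type) : S (val x).
Proof. exact/asboolP/subgroup_valP. Qed.

Definition in_subgroup (x : M) (Sx : S x) : subgroup_type :=
  SubgroupType (introT (asboolP (S x)) Sx).

Definition quotient : zmodType := Quotient.quot subgroup_pred.
Definition quo_pi : M -> quotient := \pi_quotient%qT.

Lemma quo_pi_is_additive : zmod_morphism quo_pi.
Proof. exact: raddfB. Qed.
HB.instance Definition _ :=
  GRing.isZmodMorphism.Build M quotient quo_pi quo_pi_is_additive.

Lemma quo_pi_eq (x y : M) : (quo_pi x = quo_pi y) <-> S (x - y).
Proof.
split=> [/eqP|Sxy]; first by rewrite -Quotient.idealrBE => /asboolP.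
by apply/eqP; rewrite -Quotient.idealrBE; apply/asboolP.
Qed.

Lemma quo_piK (q : quotient) : quo_pi (generic_quotient.repr q) = q.
Proof. exact: generic_quotient.reprK. Qed.

Section Desc.
Variables (N : zmodType) (f : {additive M -> N}).
Hypothesis fS : forall x, S x -> f x = 0.

Definition quo_desc_fun (q : quotient) : N := f (generic_quotient.repr q).

Lemma quo_desc_pi (x : M) : quo_desc_fun (quo_pi x) = f x.
Proof.
apply/eqP; rewrite -subr_eq0 /quo_desc_fun -raddfB; apply/eqP/fS/quo_pi_eq.
exact: quo_piK.
Qed.

Lemma quo_desc_is_additive : zmod_morphism quo_desc_fun.
Proof.
move=> p q; rewrite -(quo_piK p) -(quo_piK q) -raddfB !quo_desc_pi.
exact: raddfB.
Qed.
HB.instance Definition _ :=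
  GRing.isZmodMorphism.Build quotient N quo_desc_fun quo_desc_is_additive.

Definition quo_desc : {additive quotient -> N} := quo_desc_fun.
End Desc.

End Subgroup.

Arguments in_subgroup {M S x} Sx.

Section SubgroupMaps.
Variables (M N : zmodType) (f : {additive M -> N}).

Section Restrict.
Variables (S : subgroup M) (T : subgroup N).
Hypothesis fST : forall x, S x -> T (f x).

Definition restrict_fun (x : subgroup_type S) : subgroup_type T :=
  in_subgroup (fST (subgroupP x)).

Lemma restrict_is_additive : zmod_morphism restrict_fun.
Proof. by move=> x y; apply/val_inj; rewrite /= !raddfB. Qed.
HB.instance Definition _ :=
  GRing.isZmodMorphism.Build _ _ restrict_fun restrict_is_additive.

Definition restrict : {additive subgroup_type S -> subgroup_type T} :=
  restrict_fun.
End Restrict.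

Lemma preim_subgroup_closed (T : subgroup N) :
  T (f 0) /\ forall x y, T (f x) -> T (f y) -> T (f (x - y)).
Proof.
have [T0 TB] := subgroup_closed T.
by split=> [|x y Tx Ty]; rewrite ?raddf0 // raddfB; exact: TB.
Qed.

Definition preim_subgroup (T : subgroup N) : subgroup M :=
  @Subgroup M (fun x => T (f x)) (preim_subgroup_closed T).
End SubgroupMaps.

(* Z modulo its intersection with B; in the uses below B is contained in Z. *)
Definition subquotient (M : zmodType) (Z B : subgroup M) : zmodType :=
  quotient (@preim_subgroup (subgroup_type Z) M val B).

Section SubquotientMap.
Variables (M N : zmodType) (f : {additive M -> N}).
Variables (Z B : subgroup M) (Z' B' : subgroup N).
Hypothesis fZ : forall x, Z x -> Z' (f x).
Hypothesis fB : forall x, B x -> B' (f x).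

Definition subquotient_pre : {additive subgroup_type Z -> subquotient Z' B'} :=
  quo_pi (@preim_subgroup (subgroup_type Z') N val B') \o restrict fZ.

Lemma subquotient_preP (x : subgroup_type Z) :
  @preim_subgroup (subgroup_type Z) M val B x -> subquotient_pre x = 0.
Proof.
move=> Bx; rewrite -(raddf0 (quo_pi (@preim_subgroup (subgroup_type Z') N val B'))).
by apply/quo_pi_eq; rewrite subr0; exact: fB.
Qed.

Definition subquotient_map :
  {additive subquotient Z B -> subquotient Z' B'} := quo_desc subquotient_preP.

Lemma subquotient_mapE (z : subgroup_type Z) :
  subquotient_map (quo_pi (@preim_subgroup (subgroup_type Z) M val B) z) =
  quo_pi (@preim_subgroup (subgroup_type Z') N val B') (restrict fZ z).
Proof. exact: (quo_desc_pi subquotient_preP z). Qed.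
End SubquotientMap.

Definition dprod (I : choiceType) (M : I -> zmodType) : Type :=
  forall i, M i.

Section DProd.
Variables (I : choiceType) (M : I -> zmodType).
HB.instance Definition _ := Choice.copy (dprod M) (forall i, M i).

Let add (u v : dprod M) : dprod M := fun i => u i + v i.
Let opp (u : dprod M) : dprod M := fun i => - u i.
Let zero : dprod M := fun i => 0.

Lemma dprod_addA : associative add.
Proof. by move=> u v w; apply: functional_extensionality_dep => i; exact: addrA. Qed.
Lemma dprod_addC : commutative add.
Proof. by move=> u v; apply: functional_extensionality_dep => i; exact: addrC. Qed.
Lemma dprod_add0 : left_id zero add.
Proof. by move=> u; apply: functional_extensionality_dep => i; exact: add0r. Qed.
Lemma dprod_addN : left_inverse zero opp add.
Proof. by move=> u; apply: functional_extensionality_dep => i; exact: addNr. Qed.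
HB.instance Definition _ := GRing.isZmodule.Build (dprod M)
  dprod_addA dprod_addC dprod_add0 dprod_addN.

Lemma dprodB (u v : dprod M) i : (u - v) i = u i - v i. Proof. by []. Qed.
Lemma dprodD (u v : dprod M) i : (u + v) i = u i + v i. Proof. by []. Qed.
Lemma dprod0 i : (0 : dprod M) i = 0. Proof. by []. Qed.

Lemma dsum_closed :
  let fin_supp (u : dprod M) := finite_set [set i | u i != 0] in
  fin_supp 0 /\ forall u v, fin_supp u -> fin_supp v -> fin_supp (u - v).
Proof.
split=> [|u v fu fv].
  rewrite (_ : [set i | _] = set0); first exact: finite_set0.
  by apply/seteqP; split=> i //=; rewrite dprod0 eqxx.
apply: (@sub_finite_set _ _ ([set i | u i != 0] `|` [set i | v i != 0])).
  move=> i /=; rewrite dprodB; have [->|] := eqVneq (u i) 0; last by left.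
  by rewrite sub0r oppr_eq0; right.
by rewrite finite_setU.
Qed.

Definition fin_supp : subgroup (dprod M) := Subgroup dsum_closed.
Definition dsum : zmodType := subgroup_type fin_supp.

Lemma dsum_valD (u v : dsum) i : val (u + v) i = val u i + val v i.
Proof. by rewrite raddfD. Qed.

Lemma dsum_inj_subproof (i : I) (x : M i) :
  fin_supp (@eqtype.dfwith I M (fun=> 0) i x).
Proof.
apply: (@sub_finite_set _ _ [set i]); last exact: finite_set1.
by move=> j /=; case: eqtype.dfwithP => // k _; rewrite eqxx.
Qed.

Definition dsum_inj (i : I) (x : M i) : dsum :=
  in_subgroup (dsum_inj_subproof x).

Lemma dsum_inj_is_additive i : zmod_morphism (@dsum_inj i).
Proof.
move=> x y; apply/val_inj; apply: functional_extensionality_dep => j.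
rewrite raddfB dprodB /=; have [<-|ij] := eqVneq i j.
  by rewrite !eqtype.dfwith_in.
by rewrite !eqtype.dfwith_out ?subr0.
Qed.
HB.instance Definition _ i :=
  GRing.isZmodMorphism.Build (M i) dsum (@dsum_inj i) (@dsum_inj_is_additive i).

Section Desc.
Variables (N : zmodType) (g : forall i, {additive M i -> N}).

Definition dsum_desc_fun (u : dsum) : N := \sum_(i \in [set: I]) g i (val u i).

Lemma dsum_descE (P : set I) (u : dsum) :
  (forall i, ~ P i -> val u i = 0) ->
  dsum_desc_fun u = \sum_(i \in P) g i (val u i).
Proof.
move=> Pu; apply/esym/fsbig_widen => // i [_ /= nPi].
by rewrite Pu ?raddf0.
Qed.

Lemma dsum_desc_is_additive : zmod_morphism dsum_desc_fun.
Proof.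
have desc_add u v : dsum_desc_fun (u + v) = dsum_desc_fun u + dsum_desc_fun v.
  pose P := [set i | val u i != 0] `|` [set i | val v i != 0].
  have Pu i : ~ P i -> val u i = 0.
    by move=> nPi; apply/eqP; apply: contra_notT nPi => ?; left.
  have Pv i : ~ P i -> val v i = 0.
    by move=> nPi; apply/eqP; apply: contra_notT nPi => ?; right.
  rewrite !(@dsum_descE P) //; last first.
    by move=> i nPi; rewrite dsum_valD Pu // Pv // addr0.
  rewrite -fsbig_split; last by rewrite finite_setU; split; [exact: (subgroupP u) | exact: (subgroupP v)].
  by apply: eq_fsbigr => i _; rewrite dsum_valD raddfD.
by move=> u v; apply/eqP; rewrite eq_sym subr_eq -desc_add subrK.
Qed.
HB.instance Definition _ :=
  GRing.isZmodMorphism.Build dsum N dsum_desc_fun dsum_desc_is_additive.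

Definition dsum_desc : {additive dsum -> N} := dsum_desc_fun.

Lemma dsum_desc_inj i (x : M i) : dsum_desc (dsum_inj x) = g i x.
Proof.
rewrite [LHS](@dsum_descE [set i]) => [|j /= ji].
  by rewrite fsbig_set1 /= eqtype.dfwith_in.
by rewrite eqtype.dfwith_out //; apply/eqP => ij; apply: ji.
Qed.
End Desc.
End DProd.

(* A system may have several transition maps between two given groups; the
   limits below are taken with respect to all of them. *)
Record inverse_system := InverseSystem {
  inv_idx : choiceType;
  inv_grp : inv_idx -> zmodType;
  inv_le : inv_idx -> inv_idx -> Type;
  inv_map : forall i j, inv_le i j -> {additive inv_grp j -> inv_grp i} }.

Record direct_system := DirectSystem {
  dir_idx : choiceType;
  dir_grp : dir_idx -> zmodType;
  dir_le : dir_idx -> dir_idx -> Type;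
  dir_map : forall i j, dir_le i j -> {additive dir_grp i -> dir_grp j} }.

Section InverseLimit.
Variable D : inverse_system.

Definition compatible_family : set (dprod (@inv_grp D)) :=
  [set x | forall i j (t : inv_le i j), inv_map t (x j) = x i].

Lemma compatible_closed : compatible_family 0 /\
  forall x y, compatible_family x -> compatible_family y ->
    compatible_family (x - y).
Proof.
split=> [i j t|x y cx cy i j t]; first by rewrite !dprod0 raddf0.
by rewrite !dprodB raddfB cx cy.
Qed.

Definition compatible := Subgroup compatible_closed.
Definition inverse_limit : zmodType := subgroup_type compatible.
End InverseLimit.

Section InverseLimitMap.
Variables (D E : inverse_system) (phi : inv_idx E -> inv_idx D).
Variable phi_le : forall i j, inv_le i j -> inv_le (phi i) (phi j).
Variable h : forall i, {additive inv_grp (phi i) -> inv_grp i}.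
Hypothesis h_map : forall i j (t : inv_le i j) x,
  inv_map t (h j x) = h i (inv_map (phi_le t) x).

Definition dprod_map_fun (x : dprod (@inv_grp D)) : dprod (@inv_grp E) :=
  fun i => h i (x (phi i)).

Lemma dprod_map_is_additive : zmod_morphism dprod_map_fun.
Proof.
by move=> x y; apply: functional_extensionality_dep => i; exact: raddfB.
Qed.
HB.instance Definition _ :=
  GRing.isZmodMorphism.Build _ _ dprod_map_fun dprod_map_is_additive.

Lemma dprod_map_compatible x : compatible D x -> compatible E (dprod_map_fun x).
Proof. by move=> cx i j t; rewrite /dprod_map_fun h_map cx. Qed.

Definition inverse_limit_map : {additive inverse_limit D -> inverse_limit E} :=
  restrict dprod_map_compatible.
End InverseLimitMap.

Section DirectLimit.
Variable D : direct_system.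
Local Notation S := (dsum (@dir_grp D)).

Definition dir_relation : set S :=
  [set u | forall T : subgroup S,
     (forall i j (t : dir_le i j) (x : dir_grp i),
        T (dsum_inj x - dsum_inj (dir_map t x))) -> T u].

Lemma dir_relation_closed : dir_relation 0 /\
  forall u v, dir_relation u -> dir_relation v -> dir_relation (u - v).
Proof.
split=> [T _|u v ru rv T rT]; have [T0 TB] := subgroup_closed T => //.
by apply: TB; [exact: ru | exact: rv].
Qed.

Definition dir_relations := Subgroup dir_relation_closed.
Definition direct_limit : zmodType := quotient dir_relations.

Definition direct_limit_inj (i : dir_idx D) :
  {additive dir_grp i -> direct_limit} := quo_pi dir_relations \o @dsum_inj _ _ i.

Lemma direct_limit_injE i j (t : dir_le i j) x :
  direct_limit_inj j (dir_map t x) = direct_limit_inj i x.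
Proof. by apply/esym/quo_pi_eq => T; exact. Qed.
End DirectLimit.

Section DirectLimitMap.
Variables (D E : direct_system) (phi : dir_idx D -> dir_idx E).
Variable phi_le : forall i j, dir_le i j -> dir_le (phi i) (phi j).
Variable h : forall i, {additive dir_grp i -> dir_grp (phi i)}.
Hypothesis h_map : forall i j (t : dir_le i j) x,
  h j (dir_map t x) = dir_map (phi_le t) (h i x).

Definition direct_limit_pre : {additive dsum (@dir_grp D) -> direct_limit E} :=
  dsum_desc (fun i => direct_limit_inj (phi i) \o h i).

Lemma direct_limit_pre_relation u :
  dir_relations D u -> direct_limit_pre u = 0.
Proof.
have ker_closed : direct_limit_pre 0 = 0 /\ forall x y,
    direct_limit_pre x = 0 -> direct_limit_pre y = 0 ->
    direct_limit_pre (x - y) = 0.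
  by split=> [|x y x0 y0]; rewrite ?raddf0 // raddfB x0 y0 subr0.
move=> /(_ (@Subgroup _ [set x | direct_limit_pre x = 0] ker_closed)); apply.
move=> i j t x; rewrite /= raddfB /direct_limit_pre !dsum_desc_inj /=.
by apply/eqP; rewrite h_map subr_eq0; exact/eqP/esym/direct_limit_injE.
Qed.

Definition direct_limit_map : {additive direct_limit D -> direct_limit E} :=
  quo_desc direct_limit_pre_relation.
End DirectLimitMap.

Record scomplex (V : finType) := SComplex {
  simplices : {set {set V}};
  simplices_neq0 : finset.set0 \notin simplices;
  simplices_face : forall s t : {set V}, s \in simplices ->
    t != finset.set0 -> t \subset s -> t \in simplices }.

Record scpair (V : finType) := SCPair {
  sc_total : scomplex V;
  sc_sub : scomplex V;
  sub_total : simplices sc_sub \subset simplices sc_total }.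

Record simplicial_map (V W : finType) (P : scpair V) (Q : scpair W) :=
  SimplicialMap {
    smap :> V -> W;
    smap_total : forall s : {set V}, s \in simplices (sc_total P) ->
      [set smap x | x in s]%SET \in simplices (sc_total Q);
    smap_sub : forall s : {set V}, s \in simplices (sc_sub P) ->
      [set smap x | x in s]%SET \in simplices (sc_sub Q) }.

Definition spans (V : finType) (K : scomplex V) (w : seq V) : bool :=
  [set x in w]%SET \in simplices K.

Section Chains.
Variables (V : finType) (G : zmodType).

(* An oriented n-chain of K with coefficients in G is represented by its
   function of coefficients: c w is the coefficient of the oriented simplex
   [w_0, ..., w_n], hence changes sign when two vertices are exchanged
   (adjacent transpositions generate all permutations). An n-cochain of K is
   the same kind of function: its value on w is its value on [w_0, ..., w_n].
   The index n is an arbitrary integer: the groups vanish for n < 0, because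
   simplices are nonempty. *)
Definition oriented (K : scomplex V) (n : int) (c : seq V -> G) : Prop :=
  (forall w, c w != 0 -> [&& uniq w, spans K w & (size w)%:Z == n + 1]) /\
  (forall w1 x y w2, c (w1 ++ x :: y :: w2) = - c (w1 ++ y :: x :: w2)).

Lemma oriented_closed K n : oriented K n 0 /\
  forall c d, oriented K n c -> oriented K n d -> oriented K n (c - d).
Proof.
split=> [|c d [c1 c2] [d1 d2]]; split=> [w|w1 x y w2]; rewrite /= ?oppr0 //.
- by rewrite eqxx.
- rewrite !fctE; have [c0|/c1 //] := eqVneq (c w) 0.
  by rewrite c0 sub0r oppr_eq0 => /d1.
- by rewrite !fctE c2 d2 opprD.
Qed.

Definition chains (K : scomplex V) (n : int) : subgroup (seq V -> G) :=
  Subgroup (oriented_closed K n).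

(* The coefficient of [w_0, ..., w_(n-1)] in the boundary of the simplex
   [x, w_0, ..., w_(n-1)] is 1. There is no augmentation: the boundary of a
   0-chain is 0. *)
Definition boundary (c : seq V -> G) : seq V -> G :=
  fun w => if w is [::] then 0 else \sum_(x : V) c (x :: w).

Lemma boundary_is_additive : zmod_morphism boundary.
Proof.
move=> c d; apply/funext => -[|y w]; rewrite !fctE /= ?subr0 //.
by rewrite -sumrB.
Qed.
HB.instance Definition _ :=
  GRing.isZmodMorphism.Build _ _ boundary boundary_is_additive.

(* (delta c)[w_0, ..., w_n] is the alternating sum of the values of c on the
   faces of [w_0, ..., w_n]; for c alternating, the sum vanishes as soon as a
   vertex of w is repeated. *)
Definition coboundary (K : scomplex V) (c : seq V -> G) : seq V -> G :=
  fun w => if spans K w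
    then \sum_(i < size w) c (take i w ++ drop i.+1 w) *~ (-1) ^+ i
    else 0.

Lemma coboundary_is_additive K : zmod_morphism (coboundary K).
Proof.
move=> c d; apply/funext => w; rewrite !fctE /coboundary.
case: ifP => _; last by rewrite subr0.
by rewrite -sumrB; apply: eq_bigr => i _; rewrite -mulrzBl.
Qed.
HB.instance Definition _ K :=
  GRing.isZmodMorphism.Build _ _ (coboundary K) (coboundary_is_additive K).

Variables (P : scpair V) (n : int).

Definition relative_cycle (c : seq V -> G) : Prop :=
  chains (sc_total P) n c /\ chains (sc_sub P) (n - 1) (boundary c).

Lemma relative_cycle_closed : relative_cycle 0 /\
  forall c d, relative_cycle c -> relative_cycle d -> relative_cycle (c - d).
Proof.
have [c0 cB] := subgroup_closed (chains (sc_total P) n).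
have [b0 bB] := subgroup_closed (chains (sc_sub P) (n - 1)).
split=> [|c d [? ?] [? ?]]; split; rewrite ?raddf0 ?raddfB //;
  by [exact: cB | exact: bB].
Qed.

Definition relative_boundary (c : seq V -> G) : Prop :=
  exists d e, [/\ chains (sc_total P) (n + 1) d, chains (sc_sub P) n e &
                  c = boundary d + e].

Lemma relative_boundary_closed : relative_boundary 0 /\
  forall c d, relative_boundary c -> relative_boundary d ->
    relative_boundary (c - d).
Proof.
have [c0 cB] := subgroup_closed (chains (sc_total P) (n + 1)).
have [b0 bB] := subgroup_closed (chains (sc_sub P) n).
split=> [|_ _ [c [e [cc ce ->]]] [d [f [cd cf ->]]]].
  by exists 0, 0; rewrite raddf0 addr0.
exists (c - d), (e - f); split; [exact: cB|exact: bB|].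
by rewrite raddfB opprD addrACA.
Qed.

Definition relative_cochain (m : int) (c : seq V -> G) : Prop :=
  chains (sc_total P) m c /\ forall w, spans (sc_sub P) w -> c w = 0.

Lemma relative_cochain_closed m : relative_cochain m 0 /\
  forall c d, relative_cochain m c -> relative_cochain m d ->
    relative_cochain m (c - d).
Proof.
have [c0 cB] := subgroup_closed (chains (sc_total P) m).
split=> [|c d [? c'] [? d']]; split=> // [|w sw]; first exact: cB.
by rewrite !fctE c' // d' // subr0.
Qed.

Definition relative_cocycle (c : seq V -> G) : Prop :=
  relative_cochain n c /\ coboundary (sc_total P) c = 0.

Lemma relative_cocycle_closed : relative_cocycle 0 /\
  forall c d, relative_cocycle c -> relative_cocycle d ->
    relative_cocycle (c - d).
Proof.
have [c0 cB] := relative_cochain_closed n.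
split=> [|c d [? c'] [? d']]; split; rewrite ?raddf0 //; first exact: cB.
by apply/eqP; rewrite raddfB subr_eq0; apply/eqP; rewrite /= c' d'.
Qed.

Definition relative_coboundary (c : seq V -> G) : Prop :=
  exists2 d, relative_cochain (n - 1) d & c = coboundary (sc_total P) d.

Lemma relative_coboundary_closed : relative_coboundary 0 /\
  forall c d, relative_coboundary c -> relative_coboundary d ->
    relative_coboundary (c - d).
Proof.
have [c0 cB] := relative_cochain_closed (n - 1).
split=> [|_ _ [c cc ->] [d cd ->]]; first by exists 0; rewrite ?raddf0.
by exists (c - d); [exact: cB | rewrite raddfB].
Qed.

Definition cycles : subgroup (seq V -> G) := Subgroup relative_cycle_closed.
Definition boundaries : subgroup (seq V -> G) :=
  Subgroup relative_boundary_closed.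
Definition cocycles : subgroup (seq V -> G) :=
  Subgroup relative_cocycle_closed.
Definition coboundaries : subgroup (seq V -> G) :=
  Subgroup relative_coboundary_closed.

Definition homology : zmodType := subquotient cycles boundaries.
Definition cohomology : zmodType := subquotient cocycles coboundaries.
End Chains.

Section Induced.
Variables (V W : finType) (G : zmodType).

(* The image of the oriented simplex [v_0, ..., v_n] is [f v_0, ..., f v_n],
   which is 0 if two of its vertices coincide; in that case the terms of the
   sum below cancel. *)
Definition push (f : V -> W) (c : seq V -> G) : seq W -> G :=
  fun w => \sum_(v : (size w).-tuple V | map f v == w) c v.

Lemma push_is_additive f : zmod_morphism (push f).
Proof. by move=> c d; apply/funext => w; rewrite !fctE /push -sumrB. Qed.
HB.instance Definition _ f :=
  GRing.isZmodMorphism.Build _ _ (push f) (push_is_additive f).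

Lemma push_nil f c : push f c [::] = c [::].
Proof.
rewrite /push (bigD1 [tuple]) //= big1 ?addr0 // => i /andP[_].
by rewrite tuple0.
Qed.

Lemma push_cons f c y w :
  push f c (y :: w) = \sum_(x | f x == y) push f (fun v => c (x :: v)) w.
Proof.
rewrite /push pair_big_dep /=.
rewrite (reindex (fun p : V * (size w).-tuple V => [tuple of p.1 :: p.2])) /=.
  by apply: eq_big => [[x v]|[x v] _] //=; rewrite eqseq_cons.
exists (fun t : (size w).+1.-tuple V => (thead t, [tuple of behead t])).
  by case=> x v _ /=; congr pair; apply/val_inj.
by move=> t _; rewrite /= [RHS]tuple_eta; apply/val_inj.
Qed.

Lemma push_supp f c w : push f c w != 0 -> exists2 v, map f v = w & c v != 0.
Proof.
apply: contra_neqP => nv; rewrite /push big1 // => v /eqP fv.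
by apply/eqP; apply: contra_notT nv => cv; exists v.
Qed.

Lemma push_boundary f c : push f (boundary c) = boundary (push f c).
Proof.
apply/funext => -[|y w]; first by rewrite push_nil.
have pushE : push f (boundary c) (y :: w) =
    \sum_(x : V) push f (fun v => c (x :: v)) (y :: w).
  rewrite /push exchange_big /=; apply: eq_bigr => v.
  by case: v => [[|a v] sv] //= /eqP.
rewrite pushE /boundary (partition_big f xpredT) //=.
by apply: eq_bigr => z _; rewrite [RHS]push_cons.
Qed.

Lemma pushN f (c : seq V -> G) w : push f (fun v => - c v) w = - push f c w.
Proof. by rewrite /push sumrN. Qed.

Lemma alternating_sum (A : pred V) (F : V -> V -> G) :
  (forall a, F a a = 0) -> (forall a b, F a b = - F b a) ->
  \sum_(a | A a) \sum_(b | A b) F a b = 0.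
Proof.
move=> F0 FN; pose r := @enum_rank V : V -> 'I_#|V|.
have split_sum a : \sum_(b | A b) F a b =
    \sum_(b | A b && (r a < r b)%N) F a b +
    \sum_(b | A b && (r b < r a)%N) F a b.
  rewrite (bigID (fun b => r a < r b)%N) /=; congr (_ + _).
  rewrite (bigID (pred1 a)) /= big1 ?add0r => [|b /andP[_ /eqP ->] //].
  apply: eq_bigl => b; rewrite -leqNgt ltn_neqAle -andbA; congr andb.
  rewrite andbC; congr (~~ _ && _).
  by apply/eqP/eqP => [-> //|/val_inj/enum_rank_inj].
rewrite (eq_bigr _ (fun a _ => split_sum a)) big_split /=.
rewrite [X in _ + X](exchange_big_dep A) => [/=|? ? _ /andP[] //].
rewrite -big_split big1 //= => a Aa; apply/eqP; rewrite addr_eq0 -sumrN.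
apply/eqP; apply: eq_big => [b|b _]; last exact: FN.
by rewrite Aa.
Qed.

Lemma push_swap f c w1 x y w2 :
  (forall u1 a b u2, c (u1 ++ a :: b :: u2) = - c (u1 ++ b :: a :: u2)) ->
  push f c (w1 ++ x :: y :: w2) = - push f c (w1 ++ y :: x :: w2).
Proof.
elim: w1 c => [|z w1 IH] c cN /=; rewrite !push_cons -sumrN.
  under eq_bigr do rewrite push_cons.
  under [RHS]eq_bigr do rewrite push_cons -sumrN.
  rewrite exchange_big; apply: eq_bigr => a _; apply: eq_bigr => b _.
  rewrite -pushN; congr (push f _ w2); apply/funext => u.
  exact: (cN [::]).
apply: eq_bigr => a _; apply: IH => u1 b d u2.
exact: (cN (a :: u1)).
Qed.

Lemma push_repeat f c w1 x w2 :
  (forall u1 a b u2, c (u1 ++ a :: b :: u2) = - c (u1 ++ b :: a :: u2)) ->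
  (forall u, ~~ uniq u -> c u = 0) -> push f c (w1 ++ x :: x :: w2) = 0.
Proof.
elim: w1 c => [|z w1 IH] c cN cU /=; rewrite !push_cons.
  under eq_bigr do rewrite push_cons.
  apply: alternating_sum => [a|a b].
    by rewrite /push big1 // => v _; apply: cU; rewrite /= inE eqxx.
  rewrite -pushN; congr (push f _ w2); apply/funext => u.
  exact: (cN [::]).
rewrite big1 // => a _; apply: IH => [u1 b d u2|u uU].
  exact: (cN (a :: u1)).
by apply: cU; rewrite /= negb_and uU orbT.
Qed.

Lemma push_uniq f c w :
  (forall u1 a b u2, c (u1 ++ a :: b :: u2) = - c (u1 ++ b :: a :: u2)) ->
  (forall u, ~~ uniq u -> c u = 0) -> ~~ uniq w -> push f c w = 0.
Proof.
move=> cN cU.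
have far u : forall w1 x w2, push f c (w1 ++ x :: u ++ x :: w2) = 0.
  elim: u => [|z u IH] w1 x w2 /=; first exact: push_repeat.
  by rewrite push_swap // -cat_rcons IH oppr0.
suff split_repeat : ~~ uniq w -> exists w1 x u w2, w = w1 ++ x :: u ++ x :: w2.
  by move=> /split_repeat[w1 [x [u [w2 ->]]]].
elim: w => //= y w IH; have [/splitPr[u w2] _|_ /IH] := boolP (y \in w).
  by exists [::], y, u, w2.
by move=> [w1 [x [u [w2 ->]]]]; exists (y :: w1), x, u, w2.
Qed.

Lemma spans_map (f : V -> W) (K : scomplex V) (L : scomplex W) v :
  (forall s : {set V}, s \in simplices K -> [set f x | x in s]%SET \in simplices L) ->
  spans K v -> spans L (map f v).
Proof.
move=> fKL /fKL; rewrite /spans.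
suff -> : [set x in map f v]%SET = [set f x | x in [set x in v]%SET]%SET by [].
apply/setP => y; rewrite inE; apply/mapP/imsetP => -[x xv ->];
  by exists x; rewrite ?inE // in xv *.
Qed.

Lemma push_chains (f : V -> W) (K : scomplex V) (L : scomplex W) n c :
  (forall s : {set V}, s \in simplices K -> [set f x | x in s]%SET \in simplices L) ->
  chains G K n c -> chains G L n (push f c).
Proof.
move=> fKL [cK cN]; split=> [w cw|w1 x y w2]; last exact: push_swap.
have [v fv /cK/and3P[_ Kv sv]] := push_supp cw.
rewrite -{2 3}fv size_map sv (spans_map fKL Kv) !andbT.
apply: contra_neqT cw => /push_uniq; apply=> // u.
by apply: contraNeq => /cK/and3P[].
Qed.

(* The test reflects the convention that a cochain is extended by 0 to the
   sequences of vertices that do not span a simplex. *)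
Definition pull (K : scomplex V) (f : V -> W) (c : seq W -> G) : seq V -> G :=
  fun v => if spans K v then c (map f v) else 0.

Lemma pull_is_additive K f : zmod_morphism (pull K f).
Proof.
by move=> c d; apply/funext => v; rewrite !fctE /pull; case: ifP; rewrite ?subr0.
Qed.
HB.instance Definition _ K f :=
  GRing.isZmodMorphism.Build _ _ (pull K f) (pull_is_additive K f).

Lemma spans_nil (K : scomplex V) : spans K [::] = false.
Proof.
apply/negbTE; rewrite /spans; have -> : [set x in [::]]%SET = finset.set0 :> {set V}.
  by apply/setP => x; rewrite !inE.
exact: simplices_neq0.
Qed.

Lemma set_seq_swap (w1 : seq V) x y w2 :
  [set z in w1 ++ x :: y :: w2]%SET = [set z in w1 ++ y :: x :: w2]%SET.
Proof. by apply/setP => z; rewrite !inE !mem_cat !inE [(z == x) || _]orbCA. Qed.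

Lemma pull_coboundary K L f c n :
  (forall s : {set V}, s \in simplices K -> [set f x | x in s]%SET \in simplices L) ->
  chains G L n c -> coboundary K (pull K f c) = pull K f (coboundary L c).
Proof.
move=> fKL [cL _]; apply/funext => v; rewrite /coboundary /pull.
case: ifP => // Kv; rewrite (spans_map fKL Kv) size_map.
apply: eq_bigr => i _; rewrite -map_take -map_drop -map_cat.
case: ifPn => // nKv; apply/esym; congr (_ *~ _).
set u := take i v ++ _ in nKv *; apply/eqP; apply: contraNT nKv => cu.
apply: (@simplices_face _ K _ _ Kv); last first.
  by apply/fintype.subsetP => x; rewrite !inE mem_cat => /orP[/mem_take|/mem_drop].
apply/set0Pn; case: (u) cu => [|x u'] cu; last by exists x; rewrite !inE eqxx.
have /and3P[_ + _] := cL _ cu; rewrite /spans /=.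
have -> : [set x in [::]]%SET = finset.set0 :> {set W}.
  by apply/setP => x; rewrite !inE.
by rewrite (negbTE (simplices_neq0 L)).
Qed.

Variables (P : scpair V) (Q : scpair W) (f : simplicial_map P Q) (n : int).

Lemma pull_cochain m c :
  relative_cochain Q m c -> relative_cochain P m (pull (sc_total P) f c).
Proof.
move=> [[cQ cN] c0]; split; first split.
- move=> v; rewrite /pull; case: ifP => [Pv|_]; last by rewrite eqxx.
  by move=> /cQ/and3P[/map_uniq -> _]; rewrite size_map.
- move=> w1 x y w2; rewrite /pull /spans set_seq_swap.
  by case: ifP => _; rewrite ?oppr0 // !map_cat /= cN.
- move=> w sw; rewrite /pull; case: ifP => // _.
  exact/c0/(spans_map (@smap_sub _ _ _ _ f)).
Qed.

Lemma push_cycle c : relative_cycle P n c -> relative_cycle Q n (push f c).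
Proof.
move=> [cP bP]; split; first exact: push_chains (@smap_total _ _ _ _ f) cP.
by rewrite -push_boundary; exact: push_chains (@smap_sub _ _ _ _ f) bP.
Qed.

Lemma push_rel_boundary c :
  relative_boundary P n c -> relative_boundary Q n (push f c).
Proof.
move=> [d [e [dP eP ->]]]; exists (push f d), (push f e).
rewrite -push_boundary -raddfD; split=> //.
  exact: push_chains (@smap_total _ _ _ _ f) dP.
exact: push_chains (@smap_sub _ _ _ _ f) eP.
Qed.

Lemma pull_cocycle c :
  relative_cocycle Q n c -> relative_cocycle P n (pull (sc_total P) f c).
Proof.
move=> [cQ dc]; split; first exact: pull_cochain.
by rewrite (pull_coboundary (@smap_total _ _ _ _ f) (proj1 cQ)) dc raddf0.
Qed.

Lemma pull_rel_coboundary c :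
  relative_coboundary Q n c -> relative_coboundary P n (pull (sc_total P) f c).
Proof.
move=> [d dQ ->]; exists (pull (sc_total P) f d); first exact: pull_cochain.
by rewrite (pull_coboundary (@smap_total _ _ _ _ f) (proj1 dQ)).
Qed.

Definition homology_map : {additive homology G P n -> homology G Q n} :=
  @subquotient_map _ _ (push f) (cycles G P n) (boundaries G P n)
    (cycles G Q n) (boundaries G Q n) push_cycle push_rel_boundary.

Definition cohomology_map : {additive cohomology G Q n -> cohomology G P n} :=
  @subquotient_map _ _ (pull (sc_total P) f) (cocycles G Q n) (coboundaries G Q n)
    (cocycles G P n) (coboundaries G P n) pull_cocycle pull_rel_coboundary.
End Induced.

Section SubquotientSquare.
Variables (M N N' O : zmodType).
Variables (f : {additive M -> N}) (g : {additive N -> O}).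
Variables (f' : {additive M -> N'}) (g' : {additive N' -> O}).
Variables (Z B : subgroup M) (Z1 B1 : subgroup N) (Z2 B2 : subgroup N').
Variables (Z3 B3 : subgroup O).
Hypothesis fZ : forall x, Z x -> Z1 (f x).
Hypothesis fB : forall x, B x -> B1 (f x).
Hypothesis gZ : forall x, Z1 x -> Z3 (g x).
Hypothesis gB : forall x, B1 x -> B3 (g x).
Hypothesis f'Z : forall x, Z x -> Z2 (f' x).
Hypothesis f'B : forall x, B x -> B2 (f' x).
Hypothesis g'Z : forall x, Z2 x -> Z3 (g' x).
Hypothesis g'B : forall x, B2 x -> B3 (g' x).

Lemma subquotient_map_square (q : subquotient Z B) :
  (forall x, Z x -> g (f x) = g' (f' x)) ->
  subquotient_map gZ gB (subquotient_map fZ fB q) =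
  subquotient_map g'Z g'B (subquotient_map f'Z f'B q).
Proof.
move=> gf; rewrite -(quo_piK q); set z := generic_quotient.repr q.
rewrite !subquotient_mapE; congr (quo_pi _); apply/val_inj; exact: gf (subgroupP z).
Qed.
End SubquotientSquare.

Section Square.
Variables (V W W' U : finType) (G : zmodType) (n : int).
Variables (P : scpair V) (Q : scpair W) (Q' : scpair W') (S : scpair U).
Variables (f : simplicial_map P Q) (g : simplicial_map Q S).
Variables (f' : simplicial_map P Q') (g' : simplicial_map Q' S).
Hypothesis gf : forall v, g (f v) = g' (f' v).

Lemma push_comp (X Y T : finType) (h : X -> Y) (k : Y -> T) (c : seq X -> G) :
  push k (push h c) = push (k \o h) c.
Proof.
apply/funext => w; elim: w c => [|y w IH] c; first by rewrite !push_nil.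
rewrite !push_cons [RHS](partition_big h (fun z => k z == y)) //=.
apply: eq_bigr => z /eqP kz.
have -> : (fun v => push h c (z :: v)) =
    push h (\sum_(x | h x == z) (fun v => c (x :: v))).
  by apply/funext => v; rewrite push_cons raddf_sum fct_sumE.
rewrite IH raddf_sum fct_sumE; apply: eq_bigl => x.
by have [->|] := eqVneq (h x) z; rewrite ?kz ?eqxx ?andbF.
Qed.

Lemma homology_map_square (x : homology G P n) :
  homology_map G g n (homology_map G f n x) =
  homology_map G g' n (homology_map G f' n x).
Proof.
apply: subquotient_map_square => c _ /=; rewrite !push_comp.
by congr (push _ c); apply/funext.
Qed.

Lemma cohomology_map_square (x : cohomology G S n) :
  cohomology_map G f n (cohomology_map G g n x) =
  cohomology_map G f' n (cohomology_map G g' n x).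
Proof.
apply: subquotient_map_square => c _ /=; apply/funext => v; rewrite /pull.
case: ifP => // Pv.
rewrite !(spans_map (@smap_total _ _ _ _ _) Pv) -!map_comp.
by congr (c _); apply: eq_map.
Qed.
End Square.

(* [completely_regular_space] does not include a separation axiom. *)
Definition tychonoff_space (X : topologicalType) : Prop :=
  completely_regular_space X /\ hausdorff_space X.

(* Continuous maps into [0, 1] are continuous real functions with values in
   [0, 1]; {within A, continuous f} only depends on the restriction of f to
   A and is its continuity for the subspace topology. *)
Definition completely_closed (R : realType) (X : topologicalType)
    (A : set X) : Prop :=
  closed A /\
  forall f : X -> R, {within A, continuous f} ->
    (forall x, A x -> 0 <= f x <= 1) ->
    exists g : X -> R, [/\ continuous g, forall x, 0 <= g x <= 1 &
                           forall x, A x -> g x = f x].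

Definition functionally_open (R : realType) (X : topologicalType)
    (U : set X) : Prop :=
  exists f : X -> R, [/\ continuous f, forall x, 0 <= f x <= 1 &
                         U = f @^-1` `]0, 1]].

Section Top2cr.
Variable R : realType.

Record space_pair := SpacePair {
  space :> topologicalType;
  subspc : set space;
  space_tychonoff : tychonoff_space space;
  subspc_closed : completely_closed R subspc }.

Record pair_map (X Y : space_pair) := PairMap {
  pmap_fun :> X -> Y;
  pmap_continuous : continuous pmap_fun;
  pmap_sub : pmap_fun @` @subspc X `<=` @subspc Y }.

Lemma pair_map_eq X Y (f g : pair_map X Y) : pmap_fun f = pmap_fun g -> f = g.
Proof.
case: f g => [f cf sf] [g cg sg] /= fg; case: g / fg cg sg => cg sg.
by rewrite (Prop_irrelevance cf cg) (Prop_irrelevance sf sg).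
Qed.

Lemma pair_id_continuous (X : space_pair) : continuous (fun x : X => x).
Proof. by move=> x. Qed.

Lemma pair_id_sub (X : space_pair) :
  (fun x : X => x) @` @subspc X `<=` @subspc X.
Proof. by rewrite image_id. Qed.

Definition pair_id (X : space_pair) : pair_map X X :=
  PairMap (@pair_id_continuous X) (@pair_id_sub X).

Section Comp.
Variables (X Y Z : space_pair) (g : pair_map Y Z) (f : pair_map X Y).

Lemma pair_comp_continuous : continuous (fun x => g (f x)).
Proof.
move=> x; apply: (@continuous_comp _ _ _ f g); exact: pmap_continuous.
Qed.

Lemma pair_comp_sub : (fun x => g (f x)) @` @subspc X `<=` @subspc Z.
Proof.
by move=> _ [x Ax <-]; apply: pmap_sub; exists (f x) => //; apply: pmap_sub;
  exists x.
Qed.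

Definition pair_comp : pair_map X Z := PairMap pair_comp_continuous pair_comp_sub.
End Comp.

Definition Top2cr : category := @Category space_pair pair_map pair_id pair_comp
  (fun X Y f => pair_map_eq (f := pair_comp (pair_id Y) f) (g := f) erefl)
  (fun X Y f => pair_map_eq (f := pair_comp f (pair_id X)) (g := f) erefl)
  (fun X Y Z W h g f => pair_map_eq (f := pair_comp h (pair_comp g f))
     (g := pair_comp (pair_comp h g) f) erefl).

(* The finite index set of a cover is taken to be {0, ..., m-1}, so that the
   covers of a space form a type in the universe of the space. *)
Record fcover (X : topologicalType) := FCover {
  fc_size : nat;
  fc_mem :> 'I_fc_size -> set X;
  fc_open : forall v, functionally_open R (fc_mem v);
  fc_cover : \bigcup_v fc_mem v = setT }.

HB.instance Definition _ X := gen_eqMixin (fcover X).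
HB.instance Definition _ X := gen_choiceMixin (fcover X).

Section Nerve.
Variables (X : topologicalType) (a : fcover X).

Definition nerve_set (D : set X) : {set {set 'I_(fc_size a)}} :=
  [set s : {set 'I_(fc_size a)} | (s != finset.set0) &&
     `[< (D `&` \bigcap_(v in [set` s]) a v) !=set0 >]]%SET.

Lemma nerve_neq0 D : finset.set0 \notin nerve_set D.
Proof. by rewrite inE eqxx. Qed.

Lemma nerve_face D (s t : {set 'I_(fc_size a)}) :
  s \in nerve_set D -> t != finset.set0 -> t \subset s -> t \in nerve_set D.
Proof.
rewrite !inE => /andP[_ /asboolP[x [Dx sx]]] -> /fintype.subsetP ts /=.
by apply/asboolP; exists x; split=> // v /ts; exact: sx.
Qed.

Definition nerve (D : set X) : scomplex 'I_(fc_size a) :=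
  SComplex (nerve_neq0 D) (@nerve_face D).

Lemma nerve_sub (A : set X) :
  simplices (nerve A) \subset simplices (nerve setT).
Proof.
apply/fintype.subsetP => s; rewrite !inE => /andP[-> /asboolP[x [_ sx]]].
by apply/asboolP; exists x.
Qed.

Definition nerve_pair (A : set X) : scpair 'I_(fc_size a) :=
  SCPair (nerve_sub A).
End Nerve.

Definition refines (X : topologicalType) (a a' : fcover X) : Prop :=
  forall v', exists v, a' v' `<=` a v.

Record refproj (X : topologicalType) (a a' : fcover X) := RefProj {
  rproj :> 'I_(fc_size a') -> 'I_(fc_size a);
  rproj_sub : forall v, a' v `<=` a (rproj v) }.

Lemma refinesP (X : topologicalType) (a a' : fcover X) :
  refines a a' <-> inhabited (refproj a a').
Proof.
split=> [aa'|[p] v]; last by exists (p v); exact: rproj_sub.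
have [p pP] := choice aa'; exact: inhabits (RefProj pP).
Qed.

Section Projection.
Variables (X : topologicalType) (A : set X) (a a' : fcover X).
Variable p : refproj a a'.

Lemma rproj_nerve (D : set X) (s : {set 'I_(fc_size a')}) :
  s \in simplices (nerve a' D) ->
  [set p x | x in s]%SET \in simplices (nerve a D).
Proof.
rewrite !inE => /andP[/set0Pn[v sv] /asboolP[x [Dx sx]]]; apply/andP; split.
  by apply/set0Pn; exists (p v); exact: imset_f.
apply/asboolP; exists x; split=> // _ /imsetP[u us ->].
exact/rproj_sub/sx.
Qed.

Definition rproj_map : simplicial_map (nerve_pair a' A) (nerve_pair a A) :=
  SimplicialMap (P := nerve_pair a' A) (Q := nerve_pair a A)
    (@rproj_nerve setT) (@rproj_nerve A).
End Projection.

Section PreimageCover.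
Variables (X Y : topologicalType) (f : X -> Y) (fC : continuous f).
Variable b : fcover Y.

Lemma preimage_open v : functionally_open R (f @^-1` b v).
Proof.
have [h [hC h01 ->]] := @fc_open _ b v.
exists (h \o f); split=> // x; last exact: h01.
by apply: continuous_comp; [exact: fC | exact: hC].
Qed.

Lemma preimage_cover : \bigcup_v (f @^-1` b v) = setT.
Proof. by rewrite -preimage_bigcup fc_cover preimage_setT. Qed.

Definition fc_preimage : fcover X := FCover preimage_open preimage_cover.
End PreimageCover.

Section PreimageInclusion.
Variables (X Y : space_pair) (f : pair_map X Y) (b : fcover Y).
Local Notation fb := (fc_preimage (@pmap_continuous X Y f) b).

Lemma preimage_nerve (D : set X) (E : set Y) (s : {set 'I_(fc_size b)}) :
  f @` D `<=` E -> s \in simplices (nerve fb D) ->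
  [set id x | x in s]%SET \in simplices (nerve b E).
Proof.
move=> DE; rewrite imset_id !inE => /andP[-> /asboolP[x [Dx sx]]] /=.
by apply/asboolP; exists (f x); split; [apply: DE; exists x | exact: sx].
Qed.

Definition preimage_incl :
    simplicial_map (nerve_pair fb (@subspc X)) (nerve_pair b (@subspc Y)) :=
  SimplicialMap (P := nerve_pair fb (@subspc X))
    (Q := nerve_pair b (@subspc Y))
    (fun s => @preimage_nerve setT setT s (@subsetT _ _))
    (fun s => @preimage_nerve _ _ s (@pmap_sub _ _ f)).

Definition refproj_preimage (b' : fcover Y) (p : refproj b b') :
    refproj fb (fc_preimage (@pmap_continuous X Y f) b') :=
  @RefProj X fb (fc_preimage (@pmap_continuous X Y f) b') p
    (fun v x => @rproj_sub Y b b' p v (f x)).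
End PreimageInclusion.

Variables (G : zmodType) (n : int).

(* The transition maps p_* and p^* do not depend on the projection p; the
   limits impose the relations of all of them. *)
Definition homology_system (X : space_pair) : inverse_system :=
  @InverseSystem (fcover X) (fun a => homology G (nerve_pair a (@subspc X)) n)
    (@refproj X) (fun a a' p => homology_map G (rproj_map (@subspc X) p) n).

Definition cohomology_system (X : space_pair) : direct_system :=
  @DirectSystem (fcover X) (fun a => cohomology G (nerve_pair a (@subspc X)) n)
    (@refproj X) (fun a a' p => cohomology_map G (rproj_map (@subspc X) p) n).

Definition functional_homology (X : space_pair) : zmodType :=
  inverse_limit (homology_system X).

Definition functional_cohomology (X : space_pair) : zmodType :=
  direct_limit (cohomology_system X).

Section InducedMaps.
Variables (X Y : space_pair) (f : pair_map X Y).

Lemma preimage_incl_homology b b' (p : refproj b b') x :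
  homology_map G (rproj_map (@subspc Y) p) n
    (homology_map G (preimage_incl f b') n x) =
  homology_map G (preimage_incl f b) n
    (homology_map G (rproj_map (@subspc X) (refproj_preimage f p)) n x)
  :> homology G _ n.
Proof. exact: homology_map_square. Qed.

Lemma preimage_incl_cohomology b b' (p : refproj b b') x :
  cohomology_map G (preimage_incl f b') n
    (cohomology_map G (rproj_map (@subspc Y) p) n x) =
  cohomology_map G (rproj_map (@subspc X) (refproj_preimage f p)) n
    (cohomology_map G (preimage_incl f b) n x)
  :> cohomology G _ n.
Proof. exact: cohomology_map_square. Qed.

Definition functional_homology_map :
    {additive functional_homology X -> functional_homology Y} :=
  @inverse_limit_map (homology_system X) (homology_system Y)
    (fc_preimage (@pmap_continuous X Y f)) (@refproj_preimage X Y f)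
    (fun b => homology_map G (preimage_incl f b) n) preimage_incl_homology.

Definition functional_cohomology_map :
    {additive functional_cohomology Y -> functional_cohomology X} :=
  @direct_limit_map (cohomology_system Y) (cohomology_system X)
    (fc_preimage (@pmap_continuous X Y f)) (@refproj_preimage X Y f)
    (fun b => cohomology_map G (preimage_incl f b) n) preimage_incl_cohomology.
End InducedMaps.
End Top2cr.

(* Main.v *)
(** Pulling a cover back along the identity, or along a composite in one or in
    two steps, gives covers with the same members and the same index set, so
    the identity of the index set is a refinement projection between them, and
    hence a transition map of the systems. In the limit, compatibility with
    this transition map identifies the two covers, after which both functor
    laws reduce to equalities of simplicial maps on vertices. *)
Require Import Defs.
From mathcomp Require Import all_boot all_order all_algebra.
From mathcomp Require Import all_classical all_reals all_analysis.

Set Implicit Arguments.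
Unset Strict Implicit.
Unset Printing Implicit Defensive.

Import GRing.Theory.
Local Open Scope classical_set_scope.
Local Open Scope ring_scope.

(** Both sides are compared in each coordinate [j], where at most the summand of index [j]
    survives. *)
Lemma dsum_decomp (I : choiceType) (M : I -> zmodType) (u : dsum M) :
  u = \sum_(i \in [set i | val u i != 0]) dsum_inj (val u i).
Proof.
apply/val_inj; apply: functional_extensionality_dep => j.
have eval_sum (r : seq I) (F : I -> dsum M) :
    val (\sum_(i <- r) F i) j = \sum_(i <- r) val (F i) j.
  by elim/big_rec2: _ => [|i _ y _ <-]; rewrite ?raddf0 ?raddfD.
have fin_u : finite_set [set i | val u i != 0] by exact: (subgroupP u).
rewrite fsbig_finite // eval_sum.
(* If [val u j] vanishes, [j] is not an index of the sum, so every summand is 0 at [j]. *)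
have [uj0|uj] := eqVneq (val u j) 0.
  rewrite uj0 big1_seq // => i /andP[_]; rewrite in_fset_set // inE /= => ui.
  by rewrite eqtype.dfwith_out //; apply: contraNneq ui => ->; rewrite uj0.
rewrite (bigD1_seq j) ?fset_uniq //=; last by rewrite in_fset_set // inE.
rewrite eqtype.dfwith_in big1 ?addr0 // => i ij.
by rewrite eqtype.dfwith_out.
Qed.

(** A representative in the direct sum is a finite sum of injected elements, so their classes
    generate the limit. Thus the laws for cohomology can be checked one cover at a time. *)
Lemma direct_limit_ext (D : direct_system) (N : zmodType)
    (f g : {additive direct_limit D -> N}) :
  (forall i (x : dir_grp i),
     f (direct_limit_inj i x) = g (direct_limit_inj i x)) -> f = g.
Proof.
move=> fg; apply: additive_eq => q; rewrite -(quo_piK q) [X in quo_pi _ X]dsum_decomp.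
rewrite fsbig_finite; last exact: (subgroupP (generic_quotient.repr q)).
by rewrite !raddf_sum; apply: eq_bigr => i _; exact: fg.
Qed.

Lemma direct_limit_map_inj (D E : direct_system) (phi : dir_idx D -> dir_idx E)
    (phi_le : forall i j, dir_le i j -> dir_le (phi i) (phi j))
    (h : forall i, {additive dir_grp i -> dir_grp (phi i)})
    (h_map : forall i j (t : dir_le i j) x,
       h j (dir_map t x) = dir_map (phi_le i j t) (h i x))
    i (x : dir_grp i) :
  direct_limit_map h_map (direct_limit_inj i x) =
  direct_limit_inj (phi i) (h i x).
Proof.
rewrite [LHS](quo_desc_pi (direct_limit_pre_relation h_map)).
exact: dsum_desc_inj.
Qed.

Lemma simplicial_map_eq (V W : finType) (P : scpair V) (Q : scpair W)
    (f g : simplicial_map P Q) : f =1 g -> f = g.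
Proof.
case: f g => [f ft fs] [g gt gs] /= /funext fg; case: g / fg gt gs => gt gs.
by rewrite (Prop_irrelevance ft gt) (Prop_irrelevance fs gs).
Qed.

Section PreimageProjections.
Variable R : realType.

(** The two covers differ only in their proof components. A projection, unlike an equality of
    covers, requires no transport between their groups. *)
Definition refproj_id (X : space_pair R) (b : fcover R X) :
    refproj b (fc_preimage (@pmap_continuous R X X (pair_id X)) b) :=
  @RefProj R X b (fc_preimage (@pmap_continuous R X X (pair_id X)) b)
    id (fun v x bx => bx).

Lemma preimage_incl_id (X : space_pair R) (b : fcover R X) :
  preimage_incl (pair_id X) b = rproj_map (@subspc R X) (refproj_id b).
Proof. exact: simplicial_map_eq. Qed.

Definition refproj_comp (X Y Z : space_pair R) (g : pair_map Y Z)
    (f : pair_map X Y) (b : fcover R Z) :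
    refproj (fc_preimage (@pmap_continuous R X Z (pair_comp g f)) b)
      (fc_preimage (@pmap_continuous R X Y f)
         (fc_preimage (@pmap_continuous R Y Z g) b)) :=
  @RefProj R X (fc_preimage (@pmap_continuous R X Z (pair_comp g f)) b)
    (fc_preimage (@pmap_continuous R X Y f)
       (fc_preimage (@pmap_continuous R Y Z g) b)) id (fun v x bx => bx).

End PreimageProjections.

Lemma functional_homology_functor (R : realType) (G : zmodType) (n : int) :
  @is_functor (Top2cr R) Ab
    (fun X => functional_homology G n X)
    (fun X Y f => functional_homology_map G n f).
Proof.
split=> [X|X Y Z g f]; apply: additive_eq => x; apply/val_inj.
  apply: functional_extensionality_dep => b.
  rewrite /= /dprod_map_fun preimage_incl_id.
  exact: (subgroupP x _ _ (refproj_id b)).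
apply: functional_extensionality_dep => b; rewrite /= /dprod_map_fun.
(* Compatibility replaces the component at the one-step preimage by the image of the one at the
   two-step preimage; both composites of simplicial maps are then the identity on vertices. *)
rewrite -[val x _](subgroupP x _ _ (refproj_comp g f b)).
exact: homology_map_square.
Qed.

Lemma functional_cohomology_map_inj (R : realType) (G : zmodType) (n : int)
    (X Y : space_pair R) (f : pair_map X Y) (b : fcover R Y)
    (x : cohomology G (nerve_pair b (@subspc R Y)) n) :
  functional_cohomology_map G n f
    (@direct_limit_inj (cohomology_system G n Y) b x) =
  @direct_limit_inj (cohomology_system G n X)
    (fc_preimage (@pmap_continuous R X Y f) b)
    (cohomology_map G (preimage_incl f b) n x).
Proof.
exact: (@direct_limit_map_inj (cohomology_system G n Y) (cohomology_system G n X)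
  _ (@refproj_preimage R X Y f) (fun b => cohomology_map G (preimage_incl f b) n)
  (@preimage_incl_cohomology R G n X Y f)).
Qed.

Lemma functional_cohomology_functor (R : realType) (G : zmodType) (n : int) :
  @is_contravariant_functor (Top2cr R) Ab
    (fun X => functional_cohomology G n X)
    (fun X Y f => functional_cohomology_map G n f).
Proof.
split=> [X|X Y Z g f]; apply: direct_limit_ext => b x.
  rewrite functional_cohomology_map_inj preimage_incl_id.
  exact: (direct_limit_injE (refproj_id b : @dir_le (cohomology_system G n X) _ _)).
rewrite -[RHS]/(functional_cohomology_map G n f (functional_cohomology_map G n g
  (@direct_limit_inj (cohomology_system G n Z) b x))).
rewrite !functional_cohomology_map_inj.
(* The class at the one-step preimage is moved to the finer index, the two-step preimage, where the
   right-hand side already lives. *)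
rewrite -(direct_limit_injE
  (refproj_comp g f b : @dir_le (cohomology_system G n X) _ _)).
apply: (congr1 (direct_limit_inj _)); exact: cohomology_map_square.
Qed.

Theorem theorem1p2 (R : realType) (G : zmodType) (n : int) :
  @is_functor (Top2cr R) Ab
    (fun X => functional_homology G n X)
    (fun X Y f => functional_homology_map G n f) /\
  @is_contravariant_functor (Top2cr R) Ab
    (fun X => functional_cohomology G n X)
    (fun X Y f => functional_cohomology_map G n f).
Proof.
split; [exact: functional_homology_functor | exact: functional_cohomology_functor].
Qed.
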